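(* Let $m$ be a positive integer and let $V:S^{m-1}\to S^{m-1}$ be a dissipative quadratic stochastic operator. Then either $V$ has a unique fixed point in $S^{m-1}$, or $V$ has infinitely many fixed points in $S^{m-1}$.
   Context: The $(m-1)$-dimensional simplex is $S^{m-1}=\{x\in\mathbb{R}^m : x_i\ge 0,\ \sum_{i=1}^m x_i=1\}$. A quadratic stochastic operator (q.s.o.) is a map $V:S^{m-1}\to S^{m-1}$ of the form $(Vx)_k=\sum_{i,j=1}^m p_{ij,k}x_ix_j$ for $k=1,\dots,m$, where the coefficients satisfy $p_{ij,k}=p_{ji,k}\ge 0$ and $\sum_{k=1}^m p_{ij,k}=1$ for all $i,j$. For $x\in S^{m-1}$, let $x_{[1]}\ge x_{[2]}\ge\cdots\ge x_{[m]}$ denote the nonincreasing rearrangement of the coordinates of $x$. For $x,y\in S^{m-1}$ we write $x\prec y$ (equivalently $y\succ x$; ''$x$ is majorized by $y$'') if $\sum_{i=1}^k x_{[i]}\le\sum_{i=1}^k y_{[i]}$ for all $k=1,\dots,m-1$. An operator $V:S^{m-1}\to S^{m-1}$ is called dissipative if $Vx\succ x$ for all $x\in S^{m-1}$. By convention, linear operators (those for which there is an $m\times m$ matrix $A$ with $Vx=Ax$ for all $x\in S^{m-1}$) are excluded from the set of dissipative q.s.o.; that is, ''dissipative quadratic stochastic operator'' means a q.s.o. that is dissipative and is not linear on $S^{m-1}$. A point $x\in S^{m-1}$ is a fixed point of $V$ if $Vx=x$. *)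

(* Defs.v *)
From HB Require Import structures.
From mathcomp Require Import all_boot all_order all_algebra.
From mathcomp Require Import boolp classical_sets functions cardinality reals.

Set Implicit Arguments.
Unset Strict Implicit.
Unset Printing Implicit Defensive.

Import Order.TTheory GRing.Theory Num.Theory.

Local Open Scope classical_set_scope.
Local Open Scope ring_scope.

(* S^(m-1), as a set of column vectors of R^m *)
Definition simplex (R : realType) (m : nat) : set 'cV[R]_m :=
  [set x | (forall i, 0 <= x i 0) /\ \sum_i x i 0 = 1].

Definition rearrangement (R : realType) (m : nat) (x : 'cV[R]_m) : seq R :=
  sort (fun a b => b <= a) [seq x i 0 | i : 'I_m].

(* x is majorized by y.  Sequences are indexed from 0, so the sum over i < k
   adds the k largest coordinates. *)
Definition majorized (R : realType) (m : nat) (x y : 'cV[R]_m) : Prop :=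
  forall k : nat, (1 <= k <= m.-1)%N ->
    \sum_(i < k) (rearrangement x)`_i <= \sum_(i < k) (rearrangement y)`_i.

(* Operators on the simplex are represented by functions V on the whole of R^m;
   all the predicates below depend only on the restriction of V to the
   simplex. *)
Definition is_qso (R : realType) (m : nat) (V : 'cV[R]_m -> 'cV[R]_m) : Prop :=
  (forall x, simplex x -> simplex (V x)) /\
  exists p : 'I_m -> 'I_m -> 'I_m -> R,
    [/\ forall i j k, p i j k = p j i k,
        forall i j k, 0 <= p i j k,
        forall i j, \sum_k p i j k = 1
      & forall x, simplex x -> forall k,
          V x k 0 = \sum_i \sum_j p i j k * x i 0 * x j 0].

Definition dissipative (R : realType) (m : nat) (V : 'cV[R]_m -> 'cV[R]_m) :
  Prop := forall x, simplex x -> majorized x (V x).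

Definition linear_on_simplex (R : realType) (m : nat)
    (V : 'cV[R]_m -> 'cV[R]_m) : Prop :=
  exists A : 'M[R]_m, forall x, simplex x -> V x = A *m x.

Definition dissipative_qso (R : realType) (m : nat)
    (V : 'cV[R]_m -> 'cV[R]_m) : Prop :=
  [/\ is_qso V, dissipative V & ~ linear_on_simplex V].

Definition fixed_points (R : realType) (m : nat)
    (V : 'cV[R]_m -> 'cV[R]_m) : set 'cV[R]_m :=
  [set x | simplex x /\ V x = x].

(* Main.v *)
(* Dissipativity at the vertices gives a map [f] with [V e_i = e_(f i)], and on
   the edges [p i j (f i) >= 1/2].  Hence, on a face whose vertices have
   distinct images under [f], [V] is the linear map [e_i |-> e_(f i)].

   The support of a fixed point [x] spans such a face.  Suppose [i <> j] lie in
   the support and [f i = f j]; put [h = e_i - e_j].  Majorization bounds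
   [sum_l |y_l - v|] by its value at [V y]; comparing second differences at [x]
   in the direction [h], for all values [v] of coordinates of [x], shows that
   the derivative of [V] at [x] does not decrease the l1-norm of [h].  But
   [p i l] and [p j l] are at l1-distance at most 1, since both give mass at
   least 1/2 to [f i], and this makes the derivative strictly decrease it.

   It follows that [f] permutes the support of every fixed point, so that two
   supports together still span a face on which [V] is linear, and the whole
   segment between two fixed points is fixed.  The barycentre of a cycle of [f]
   is always fixed. *)

Require Import Defs.
From HB Require Import structures.
From mathcomp Require Import all_boot all_order all_algebra.
From mathcomp Require Import boolp classical_sets functions cardinality reals.
From mathcomp Require Import ring lra.

Set Implicit Arguments.
Unset Strict Implicit.
Unset Printing Implicit Defensive.

Import Order.TTheory GRing.Theory Num.Theory.

Local Open Scope classical_set_scope.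
Local Open Scope ring_scope.

(** * Convex sums under majorization *)

Section Majorization.
Variables (R : realType) (m : nat).
Implicit Types (x y : 'cV[R]_m) (v : R).

Lemma big_rearrangement (f : R -> R) x :
  \sum_i f (x i 0) = \sum_(a <- rearrangement x) f a.
Proof.
rewrite /rearrangement (perm_big [seq x i 0 | i : 'I_m]) /=; last first.
  by rewrite perm_sort.
by rewrite big_image.
Qed.

Lemma size_rearrangement x : size (rearrangement x) = m.
Proof. by rewrite size_sort size_image card_ord. Qed.

(** The entries above [v] come first in a nonincreasing sequence. *)
Lemma sum_posp_take (s : seq R) v : sorted (fun a b => b <= a) s ->
  exists2 k, (k <= size s)%N &
    \sum_(a <- s) Num.max (a - v) 0 = \sum_(a <- take k s) (a - v).
Proof.
have ge_trans : transitive (fun a b : R => b <= a).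
  by move=> b a c /= ba cb; exact: le_trans ba.
elim: s => [|a s IHs] /= ss; first by exists 0%N; rewrite ?big_nil.
have [va|av] := ltP v a.
  have [k ks Ek] := IHs (path_sorted ss).
  exists k.+1 => //; rewrite /= !big_cons Ek; congr (_ + _).
  by apply/max_idPl; rewrite subr_ge0 ltW.
exists 0%N; rewrite ?take0 ?big_nil //; apply: big1_seq => b /= bas.
apply/max_idPr; rewrite subr_le0; apply: le_trans av.
move: bas; rewrite inE => /predU1P[->//|bs].
by move: ss; rewrite path_sortedE // => /andP[/allP/(_ b bs)].
Qed.

(** The left side is the sum of the [k] largest coordinates of [x] minus [k * v]. Majorization
    replaces [x] by [y], and passing to positive parts only increases the result. *)
Lemma majorized_sum_posp x y v :
  majorized x y -> \sum_i x i 0 = \sum_i y i 0 ->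
  \sum_i Num.max (x i 0 - v) 0 <= \sum_i Num.max (y i 0 - v) 0.
Proof.
move=> xy Exy; set s := rearrangement x; set t := rearrangement y.
have take_sum (z : 'cV[R]_m) (n : nat) : (n <= m)%N -> \sum_(a <- take n (rearrangement z)) (a - v)
    = \sum_(i < n) (rearrangement z)`_i - v *+ n.
  move=> nm; rewrite (big_nth (0 : R)) size_takel ?size_rearrangement // big_mkord.
  rewrite -[in X in _ = _ - X](card_ord n) -sumr_const -sumrB; apply: eq_bigr.
  by move=> i _; rewrite nth_take.
have full (z : 'cV[R]_m) : \sum_(i < m) (rearrangement z)`_i = \sum_i z i 0.
  by rewrite (big_rearrangement id) (big_nth (0 : R)) size_rearrangement big_mkord.
have ss : sorted (fun a b => b <= a) s.
  by apply: sort_sorted => a b; exact: le_total.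
rewrite !(big_rearrangement (fun a => Num.max (a - v) 0)) -/s -/t.
have [k ks ->] := sum_posp_take v ss.
rewrite size_rearrangement in ks.
apply: (@le_trans _ _ (\sum_(a <- take k t) (a - v))).
  rewrite !take_sum // lerD2r.
  (* Majorization speaks of [1 <= k <= m.-1] only; [k = 0] is trivial and [k = m] compares the equal
     totals. *)
  have [->|k0] := posnP k; first by rewrite !big_ord0.
  have [km|km] := leqP k m.-1; first by apply: xy; rewrite k0.
  have -> : k = m by apply/eqP; rewrite eqn_leq ks -(ltn_predK (leq_trans k0 ks)).
  by rewrite !full Exy.
rewrite -[in leRHS](cat_take_drop k t) big_cat /=.
rewrite -[leLHS]addr0; apply: lerD; last first.
  by apply: sumr_ge0 => a _; rewrite le_max lexx orbT.
by apply: ler_sum => a _; rewrite le_max lexx.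
Qed.

Lemma majorized_sum_norm x y v :
  majorized x y -> \sum_i x i 0 = \sum_i y i 0 ->
  \sum_i `|x i 0 - v| <= \sum_i `|y i 0 - v|.
Proof.
move=> xy Exy.
have normE (z : 'cV[R]_m) : \sum_i `|z i 0 - v| =
    \sum_i Num.max (z i 0 - v) 0 *+ 2 - (\sum_i z i 0 - \sum_(i < m) v).
  rewrite -!sumrB; apply: eq_bigr => i _.
  case: (lerP 0 (z i 0 - v)) => h; first by rewrite ger0_norm // mulr2n addrK.
  by rewrite ltr0_norm // mul0rn sub0r.
by rewrite !normE Exy lerD2r !sumrMnl lerMn2r /= majorized_sum_posp.
Qed.

(** With [v] the largest coordinate of [y], the positive parts for [y] vanish, hence also those for
    [x]. *)
Lemma majorized_le_max x y (l : 'I_m) :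
  majorized x y -> \sum_i x i 0 = \sum_i y i 0 ->
  exists k, x l 0 <= y k 0.
Proof.
move=> xy Exy; pose k := [arg max_(k > l) y k 0]%O; exists k.
have ymax i : y i 0 <= y k 0 by rewrite /k; case: arg_maxP => //= j _; exact.
have := majorized_sum_posp (y k 0) xy Exy.
rewrite [leRHS]big1 => [|i _]; last by apply/max_idPr; rewrite subr_le0.
rewrite (bigD1 l) //= => h; rewrite -subr_le0.
apply: le_trans h; apply: (@le_trans _ _ (Num.max (x l 0 - y k 0) 0)).
  by rewrite le_max lexx.
by rewrite lerDl; apply: sumr_ge0 => i _; rewrite le_max lexx orbT.
Qed.

End Majorization.

(** * Second differences of the absolute value *)

Section SecondDifference.
Variable R : realType.
Implicit Types a b c d e h : R.

(** Convexity of the absolute value, with a gain of order [e] at the kink [a = 0]. *)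
Lemma second_difference_ge a h e : 0 <= e ->
  `|a| *+ 2 + (if a == 0 then e * `|h| *+ 2 else 0) <= `|a + e * h| + `|a - e * h|.
Proof.
move=> e0; have [->|a0] := eqVneq.
  by rewrite normr0 mul0rn !add0r normrN normrM (ger0_norm e0) mulr2n.
rewrite addr0 -normrMn mulr2n; apply: le_trans (ler_normD _ _).
by rewrite addrACA subrr addr0.
Qed.

(** Away from the kink the second difference has order [e ^+ 2]. At [a = 0] the last quotient is
    [0], by the convention [0^-1 = 0]. *)
Lemma second_difference_le a b d e : 0 <= e ->
  `|a + (e * d + e ^+ 2 * b)| + `|a + (- (e * d) + e ^+ 2 * b)| <=
  `|a| *+ 2 + (if a == 0 then e * `|d| *+ 2 else 0) +
  e ^+ 2 * (`|b| *+ 2 + d ^+ 2 / `|a|).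
Proof.
move=> e0; have nb u : `|u + e ^+ 2 * b| <= `|u| + e ^+ 2 * `|b|.
  by apply: le_trans (ler_normD _ _) _; rewrite normrM (ger0_norm (sqr_ge0 e)).
rewrite !addrA; apply: le_trans (lerD (nb _) (nb _)) _.
have -> : forall u w : R, u + e ^+ 2 * `|b| + (w + e ^+ 2 * `|b|) =
   u + w + e ^+ 2 * (`|b| *+ 2) by move=> u w; rewrite mulr2n; ring.
rewrite [e ^+ 2 * (_ + _ / _)]mulrDr [e ^+ 2 * (_ *+ 2) + _]addrC [leRHS]addrA lerD2r.
have [->|a0] := eqVneq.
  rewrite normr0 invr0 !mulr0 addr0 mul0rn !add0r normrN normrM.
  by rewrite (ger0_norm e0) mulr2n.
(* [|a+u| + |a-u| = 2 max(|a|,|u|)] and [2 |u| <= |a| + u^2/|a|] by AM-GM. *)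
rewrite addr0; set u := e * d; rewrite mulrA -exprMn -/u.
have A0 : 0 < `|a| by rewrite normr_gt0.
have uu : u ^+ 2 / `|a| = (`|u| / `|a|) ^+ 2 * `|a|.
  by rewrite expr_div_n real_normK ?num_real //; field; rewrite gt_eqF.
have AG : `|u| *+ 2 <= `|a| *+ 2 + u ^+ 2 / `|a|.
  rewrite uu; set r := `|u| / `|a|.
  have -> : `|u| = r * `|a| by rewrite /r mulfVK // gt_eqF.
  have : 0 <= (r - 1) ^+ 2 * `|a| by rewrite mulr_ge0 ?sqr_ge0 // ltW.
  by rewrite !mulr2n; nra.
have P : 0 <= u ^+ 2 / `|a| by rewrite divr_ge0 ?sqr_ge0 // ltW.
move: AG P; move: (u ^+ 2 / `|a|) => q; rewrite !mulr2n => AG P.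
by case: (ger0P (a + u)) (ger0P (a - u)) AG => [h1|h1] [h2|h2];
  case: (ger0P a) => ?; case: (ger0P u) => ?; lra.
Qed.

Lemma le_of_le_add_small a b c e0 : 0 < e0 ->
  (forall e, 0 < e <= e0 -> a <= b + e * c) -> a <= b.
Proof.
move=> e0_gt0 H; rewrite leNgt; apply/negP => ba.
have c0 : 0 < `|c| + 1 by rewrite ltr_wpDl.
pose e := Num.min e0 ((a - b) / (`|c| + 1) / 2).
have q0 : 0 < (a - b) / (`|c| + 1) by rewrite divr_gt0 // subr_gt0.
have e_gt0 : 0 < e by rewrite lt_min e0_gt0 divr_gt0.
have /H : 0 < e <= e0 by rewrite e_gt0 ge_min lexx.
have : e * (`|c| + 1) <= (a - b) / 2.
  by rewrite -ler_pdivlMr // mulrAC ge_min lexx orbT.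
have : e * c <= e * (`|c| + 1).
  by rewrite ler_pM2l //; apply: le_trans (ler_norm c) _; rewrite lerDl.
lra.
Qed.

End SecondDifference.

(** Allows l1-norms to be compared on one level set of [x] at a time, where all coordinates share
    the kink [v]. *)
Lemma sum_level_sets (R : realType) (I : finType) (x F : I -> R) :
  \sum_(v <- undup (codom x)) \sum_(i | x i == v) F i = \sum_i F i.
Proof.
rewrite (exchange_big_dep predT) //=; apply: eq_bigr => i _.
under eq_bigl do rewrite eq_sym.
by rewrite -big_filter filter_pred1_uniq ?undup_uniq ?mem_undup ?codom_f // big_seq1.
Qed.

(** * The bilinear form of the operator, and segments in the simplex *)

Section DissipativeOperators.
Variables (R : realType) (m : nat) (V : 'cV[R]_m -> 'cV[R]_m).
Variable p : 'I_m -> 'I_m -> 'I_m -> R.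
Hypothesis Vsimplex : forall x, simplex x -> simplex (V x).
Hypothesis p_sym : forall i j k, p i j k = p j i k.
Hypothesis p_ge0 : forall i j k, 0 <= p i j k.
Hypothesis p_sum : forall i j, \sum_k p i j k = 1.
Hypothesis VE : forall x, simplex x ->
  forall k, V x k 0 = \sum_i \sum_j p i j k * x i 0 * x j 0.
Hypothesis V_dissipative : dissipative V.

(** The symmetric bilinear form whose diagonal gives coordinate [k] of [V] on the simplex. *)
Definition polar k (u w : 'cV[R]_m) := \sum_i \sum_j p i j k * u i 0 * w j 0.

Lemma polarC k u w : polar k u w = polar k w u.
Proof.
rewrite /polar exchange_big; apply: eq_bigr => j _; apply: eq_bigr => i _.
by rewrite p_sym mulrAC.
Qed.

Lemma polarDr k u v w : polar k u (v + w) = polar k u v + polar k u w.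
Proof.
rewrite -big_split; apply: eq_bigr => i _; rewrite -big_split.
by apply: eq_bigr => j _; rewrite mxE mulrDr.
Qed.

Lemma polarZr k c u w : polar k u (c *: w) = c * polar k u w.
Proof.
rewrite mulr_sumr; apply: eq_bigr => i _; rewrite mulr_sumr.
by apply: eq_bigr => j _; rewrite mxE mulrCA.
Qed.

Lemma polarNr k u w : polar k u (- w) = - polar k u w.
Proof. by rewrite -scaleN1r polarZr mulN1r. Qed.

Lemma polarDl k u v w : polar k (u + v) w = polar k u w + polar k v w.
Proof. by rewrite !(polarC _ _ w) polarDr. Qed.

Lemma polarZl k c u w : polar k (c *: u) w = c * polar k u w.
Proof. by rewrite !(polarC _ _ w) polarZr. Qed.

Lemma polar_delta k u j : polar k u (delta_mx j 0) = \sum_i u i 0 * p i j k.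
Proof.
apply: eq_bigr => i _; rewrite (bigD1 j) //= big1 => [|l lj].
  by rewrite mxE !eqxx mulr1 addr0 mulrC.
by rewrite mxE (negPf lj) mulr0.
Qed.

Lemma polar_delta2 k i j : polar k (delta_mx i 0) (delta_mx j 0) = p i j k.
Proof.
rewrite polar_delta (bigD1 i) //= big1 => [|l li].
  by rewrite mxE !eqxx mul1r addr0.
by rewrite mxE (negPf li) mul0r.
Qed.

Lemma polar_expansion k x h e :
  polar k (x + e *: h) (x + e *: h) =
  polar k x x + (e * (polar k x h *+ 2) + e ^+ 2 * polar k h h).
Proof.
rewrite polarDl !polarDr !polarZl !polarZr (polarC _ h x) mulr2n.
by ring.
Qed.

Lemma simplex_delta (i : 'I_m) : simplex (delta_mx i 0 : 'cV[R]_m).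
Proof.
split=> [j|]; first by rewrite mxE ler0n.
by rewrite (bigD1 i) //= mxE !eqxx big1 ?addr0 // => j ji; rewrite mxE (negPf ji).
Qed.

Lemma simplex_segment (x y : 'cV[R]_m) t : simplex x -> simplex y ->
  0 <= t <= 1 -> simplex (x + t *: (y - x)).
Proof.
move=> [x0 x1] [y0 y1] /andP[t0 t1]; split=> [i|].
  rewrite !mxE; have := x0 i; have := y0 i; nra.
under eq_bigr do rewrite !mxE.
by rewrite big_split /= -mulr_sumr sumrB x1 y1 subrr mulr0 addr0.
Qed.

Lemma V_sum x : simplex x -> \sum_i x i 0 = \sum_i V x i 0.
Proof. by move=> sx; rewrite (Vsimplex sx).2 sx.2. Qed.

(** * Dissipativity at the vertices and on the edges *)

Lemma V_le_max x l : simplex x -> exists k, x l 0 <= V x k 0.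
Proof.
by move=> sx; apply: majorized_le_max (V_dissipative sx) (V_sum sx).
Qed.

Lemma V_vertices : exists f : 'I_m -> 'I_m, forall i, p i i (f i) = 1.
Proof.
apply: (@fin_all_exists _ (fun=> 'I_m) (fun i k => p i i k = 1)) => i.
have [k] := V_le_max i (simplex_delta i).
rewrite (VE (simplex_delta i)) -/(polar k _ _) polar_delta2 mxE !eqxx => pk.
exists k; apply/eqP; rewrite eq_le pk andbT -(p_sum i i) (bigD1 k) //=.
by rewrite lerDl sumr_ge0.
Qed.

Variable f : 'I_m -> 'I_m.
Hypothesis p_vertex : forall i, p i i (f i) = 1.

Lemma p_vertexE i k : p i i k = (k == f i)%:R.
Proof.
have [->|ki] := eqVneq k; first exact: p_vertex.
apply/eqP; rewrite eq_le p_ge0 andbT.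
have := p_sum i i; rewrite (bigD1 (f i)) //= p_vertex (bigD1 k) //=.
have : 0 <= \sum_(l | (l != f i) && (l != k)) p i i l by rewrite sumr_ge0.
by lra.
Qed.

Lemma p_le1 i j k : p i j k <= 1.
Proof. by rewrite -(p_sum i j) (bigD1 k) //= lerDl sumr_ge0. Qed.

(* Near the vertex [e_i] of the edge [e_i e_j] the largest coordinate decreases
   at unit speed, so that of the image may not decrease faster. *)
Lemma p_ge_half i j : 2^-1 <= p i j (f i).
Proof.
rewrite leNgt; apply/negP => ph.
(* With [p i j (f i) = (1 - 8 * t) / 2], coordinate [f i] of the image is at most
   [1 - t - 7 * t ^+ 2 + 8 * t ^+ 3 < 1 - t]; the other coordinates are at most [2 * t]. *)
pose t := (1 - 2 * p i j (f i)) / 8.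
have p0 := p_ge0 i j (f i).
have t0 : 0 < t by rewrite /t; lra.
have t8 : t <= 8^-1 by rewrite /t; lra.
have ij : i != j.
  by apply: contraTN ph => /eqP <-; rewrite -leNgt p_vertex; lra.
have sx : simplex (delta_mx i 0 + t *: (delta_mx j 0 - delta_mx i 0) : 'cV[R]_m).
  apply: simplex_segment; try exact: simplex_delta.
  by apply/andP; split; lra.
have [k] := V_le_max i sx.
rewrite (VE sx) -/(polar k _ _) polar_expansion !polarDr !polarDl !polarNr.
rewrite !(polarC _ (- _)) !polarNr !polar_delta2 !mxE !eqxx (negPf ij) /=.
rewrite !p_vertexE (p_sym j i).
have t2 : 0 < t ^+ 2 by rewrite exprn_gt0.
have t2t : t ^+ 2 <= t * 8^-1 by rewrite ler_pM2l.
have [-> {k}|kf] := eqVneq k (f i).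
  have t3 : t ^+ 2 * t <= t ^+ 2 * 8^-1 by rewrite ler_pM2l.
  have -> : p i j (f i) = (1 - 8 * t) / 2 by rewrite /t; field.
  by case: (_ == _); rewrite /= ?mulr1n ?mulr0n -mulr_natl; lra.
have : t * p i j k <= t * 1 by rewrite ler_pM2l ?p_le1.
have : 0 <= t ^+ 2 * p i j k by rewrite mulr_ge0 // ltW.
by case: (_ == _); rewrite /= ?mulr1n ?mulr0n -mulr_natl; lra.
Qed.

(** If the masses at the common image are [a, b >= 1/2], the distance is at most [|a - b| + (1 - a)
    + (1 - b) = 2 - 2 * min(a, b)]. *)
Lemma p_distance i j k : f j = f k -> \sum_l `|p i j l - p i k l| <= 1.
Proof.
move=> jk; rewrite (bigD1 (f j)) //=.
have a1 := p_ge_half j i; have a2 := p_ge_half k i.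
rewrite -jk !(p_sym _ i) in a1 a2.
have Ej := p_sum i j; have Ek := p_sum i k.
rewrite (bigD1 (f j)) //= in Ej; rewrite (bigD1 (f j)) //= in Ek.
have : \sum_(l | l != f j) `|p i j l - p i k l| <=
       \sum_(l | l != f j) p i j l + \sum_(l | l != f j) p i k l.
  rewrite -big_split; apply: ler_sum => l _; apply: le_trans (ler_normB _ _) _.
  by rewrite !ger0_norm.
by case: (lerP 0 (p i j (f j) - p i k (f j))) => h;
  [rewrite ger0_norm | rewrite ltr0_norm]; lra.
Qed.

(* The second difference of [fun y => sum_l |y_l - v|] at a fixed point, of
   order one in [e], may not decrease under [V]; the second order term of [V]
   does not contribute to it. *)
Lemma fixed_derivative_ge x h e0 : fixed_points V x -> 0 < e0 ->
  (forall e, `|e| <= e0 -> simplex (x + e *: h)) ->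
  \sum_l `|h l 0| <= \sum_l `|polar l x h *+ 2|.
Proof.
move=> [sx Vx] e0_gt0 sxh.
rewrite -(sum_level_sets (fun l => x l 0)).
rewrite -[leRHS](sum_level_sets (fun l => x l 0)); apply: ler_sum => v _.
pose d l := polar l x h *+ 2; pose b l := polar l h h.
pose a l := x l 0 - v.
(* [C] collects the terms of order [e ^+ 2]; after division by [2 * e] they leave the error
   [e * (C / 2)]. *)
pose C := \sum_l (`|b l| *+ 2 + d l ^+ 2 / `|a l|).
apply: (@le_of_le_add_small _ _ _ (C / 2) e0) => // e /andP[e_gt0 ee0].
have ep : `|e| <= e0 by rewrite gtr0_norm.
have en : `|- e| <= e0 by rewrite normrN.
have Vxe e' l : `|e'| <= e0 -> V (x + e' *: h) l 0 = x l 0 + (e' * d l + e' ^+ 2 * b l).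
  by move=> he; rewrite (VE (sxh _ he)) -/(polar l _ _) polar_expansion
     -/(d l) -/(b l) -[X in X + _ = _](VE sx) Vx.
have := lerD (majorized_sum_norm v (V_dissipative (sxh _ ep)) (V_sum (sxh _ ep)))
             (majorized_sum_norm v (V_dissipative (sxh _ en)) (V_sum (sxh _ en))).
rewrite -!big_split /= => H.
have {}H : \sum_l (`|a l| *+ 2 + (if a l == 0 then e * `|h l 0| *+ 2 else 0)) <=
  \sum_l (`|a l| *+ 2 + (if a l == 0 then e * `|d l| *+ 2 else 0) +
          e ^+ 2 * (`|b l| *+ 2 + d l ^+ 2 / `|a l|)).
  apply: le_trans (le_trans H _); apply: ler_sum => l _.
    rewrite !mxE mulNr !(addrAC (x l 0) _ (- v)).
    by apply: second_difference_ge; exact: ltW.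
  rewrite (Vxe _ _ ep) (Vxe _ _ en) sqrrN mulNr !(addrAC (x l 0) _ (- v)).
  by apply: second_difference_le; exact: ltW.
move: H; rewrite !big_split /= -!addrA !lerD2l -!big_mkcond /= -mulr_sumr -/C.
have aE F : \sum_(l | a l == 0) (e * F l *+ 2) = e * 2 * \sum_(l | x l 0 == v) F l.
  rewrite mulr_sumr; apply: eq_big => l; first by rewrite /a subr_eq0.
  by rewrite -mulr_natr mulrAC.
rewrite !aE => H.
rewrite -(ler_pM2l (mulr_gt0 e_gt0 (ltr0n R 2))); apply: le_trans H _.
by rewrite le_eqVlt; apply/orP; left; apply/eqP; field.
Qed.

(** Since [p i i] and [p j j] coincide, the weights of [i] and [j] enter the derivative as
    [|x_i - x_j|], which is less than [x_i + x_j]. Its norm is thus below [2], the norm of [h]. *)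
Lemma fixed_injective x i j : fixed_points V x ->
  0 < x i 0 -> 0 < x j 0 -> f i = f j -> i = j.
Proof.
move=> Fx xi xj fij; apply/eqP; apply: contraT => ij.
have [[x0 x1] _] := Fx.
pose h : 'cV[R]_m := delta_mx i 0 - delta_mx j 0.
have hE l : h l 0 = (l == i)%:R - (l == j)%:R by rewrite !mxE !eqxx !andbT.
have e_gt0 : 0 < Num.min (x i 0) (x j 0) by rewrite lt_min xi.
suff sxh e : `|e| <= Num.min (x i 0) (x j 0) -> simplex (x + e *: h).
  have := fixed_derivative_ge Fx e_gt0 sxh; rewrite leNgt => /negP[].
  have sumE (F : 'I_m -> R) :
      \sum_l F l = F i + F j + \sum_(l | (l != i) && (l != j)) F l.
    by rewrite (bigD1 i) //= (bigD1 j) ?addrA // eq_sym.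
  rewrite [ltRHS]sumE !hE !eqxx (negPf ij) eq_sym (negPf ij) subr0 sub0r normrN1 normr1.
  rewrite [X in _ < _ + X]big1; last first.
    by move=> l /andP[li lj]; rewrite hE (negPf li) (negPf lj) subrr normr0.
  have -> : \sum_l `|polar l x h *+ 2| =
      2 * \sum_l `|(x i 0 - x j 0) * (p i i l - p i j l) +
        \sum_(k | (k != i) && (k != j)) x k 0 * (p k i l - p k j l)|.
    rewrite mulr_sumr; apply: eq_bigr => l _.
    rewrite normrMn -[LHS]mulr_natl; congr (_ * `|_|).
    rewrite polarDr polarNr !polar_delta -sumrB sumE.
    congr (_ + _); first by rewrite (p_sym j i) !p_vertexE fij; ring.
    by apply: eq_bigr => k _; rewrite mulrBr.
  have : \sum_l `|(x i 0 - x j 0) * (p i i l - p i j l) +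
        \sum_(k | (k != i) && (k != j)) x k 0 * (p k i l - p k j l)| <=
     `|x i 0 - x j 0| + \sum_(k | (k != i) && (k != j)) x k 0.
    apply: (@le_trans _ _ (\sum_l (`|x i 0 - x j 0| * `|p i i l - p i j l| +
       \sum_(k | (k != i) && (k != j)) x k 0 * `|p k i l - p k j l|))).
      apply: ler_sum => l _; apply: le_trans (ler_normD _ _) _.
      rewrite normrM lerD2l; apply: le_trans (ler_norm_sum _ _ _) _.
      by apply: ler_sum => k _; rewrite normrM (ger0_norm (x0 k)).
    rewrite big_split exchange_big /= -mulr_sumr; apply: lerD.
      by rewrite ler_piMr // p_distance.
    by apply: ler_sum => k _; rewrite -mulr_sumr ler_piMr // p_distance.
  have : x i 0 + x j 0 + \sum_(k | (k != i) && (k != j)) x k 0 = 1 by rewrite -sumE.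
  move: (\sum_l _) (\sum_(k | _) _) => A B EB.
  by case: (lerP 0 (x i 0 - x j 0)) => hh;
    [rewrite ger0_norm | rewrite ltr0_norm]; lra.
move=> he; have : `|e| <= x i 0 /\ `|e| <= x j 0.
  by move: he; rewrite le_min => /andP[].
rewrite !ler_norml => -[/andP[e1 e2] /andP[e3 e4]].
split=> [l|].
  rewrite mxE [X in _ + X]mxE hE; have [->|li] := eqVneq l i.
    by rewrite (negPf ij) subr0 mulr1; lra.
  have [->|lj] := eqVneq l j; first by rewrite sub0r mulrN1; lra.
  by rewrite subrr mulr0 addr0.
have h0 : \sum_l h l 0 = 0.
  rewrite /h; under eq_bigr do rewrite mxE [X in _ + X]mxE.
  by rewrite sumrB (simplex_delta i).2 (simplex_delta j).2 subrr.
under eq_bigr do rewrite mxE [X in _ + X]mxE.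
by rewrite big_split /= x1 -mulr_sumr h0 mulr0 addr0.
Qed.

(** * Faces on which the operator is linear *)

Lemma p_distinct_images i j k : f i != f j ->
  p i j k = ((f i == k)%:R + (f j == k)%:R) / 2.
Proof.
move=> fij; have a1 := p_ge_half i j; have a2 := p_ge_half j i.
rewrite (p_sym j i) in a2.
have E := p_sum i j.
rewrite (bigD1 (f i)) //= (bigD1 (f j)) 1?eq_sym //= in E.
(* The masses at [f i] and [f j] are at least one half each, so nothing is left for the other
   indices. *)
have rest0 : 0 <= \sum_(l | (l != f i) && (l != f j)) p i j l by rewrite sumr_ge0.
have [<-|ki] := eqVneq (f i) k.
  by rewrite eq_sym (negPf fij) addr0 mulr1n; lra.
have [<-|kj] := eqVneq (f j) k; first by rewrite add0r mulr1n; lra.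
rewrite addr0 mul0r; apply/eqP; rewrite eq_le p_ge0 andbT.
have : p i j k <= \sum_(l | (l != f i) && (l != f j)) p i j l.
  by rewrite (bigD1 k) /= ?[k == _]eq_sym ?ki // lerDl sumr_ge0.
lra.
Qed.

(** On the support, [p i j] is the mean of the point masses at [f i] and [f j], so the double sum
    factors through [\sum_i x i 0 = 1]. *)
Lemma V_linear_of_injective x : simplex x ->
  (forall i j, 0 < x i 0 -> 0 < x j 0 -> f i = f j -> i = j) ->
  forall k, V x k 0 = \sum_(i | f i == k) x i 0.
Proof.
move=> sx finj k; have [x0 x1] := sx; rewrite (VE sx).
pose F i := (f i == k)%:R * x i 0.
have -> : \sum_(i | f i == k) x i 0 = \sum_i F i.
  by rewrite big_mkcond; apply: eq_bigr => i _; rewrite /F mulr_natl mulrb.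
transitivity (\sum_i \sum_j (F i * x j 0 + x i 0 * F j) / 2).
  apply: eq_bigr => i _; apply: eq_bigr => j _; rewrite /F.
  have [xi|] := ltP 0 (x i 0); last first.
    move=> xi; have -> : x i 0 = 0 by apply/eqP; rewrite eq_le xi x0.
    by ring.
  have [xj|] := ltP 0 (x j 0); last first.
    move=> xj; have -> : x j 0 = 0 by apply/eqP; rewrite eq_le xj x0.
    by ring.
  have [fij|fij] := eqVneq (f i) (f j).
    by rewrite -(finj _ _ xi xj fij) p_vertexE eq_sym; field.
  by rewrite (p_distinct_images _ fij); field.
under eq_bigr do rewrite -mulr_suml big_split -!mulr_sumr x1 mulr1.
by rewrite -mulr_suml big_split /= -mulr_suml x1 mul1r; field.
Qed.

(** * Supports of fixed points, and segments between them *)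

Lemma fixed_support_stable x i : fixed_points V x -> 0 < x i 0 -> 0 < x (f i) 0.
Proof.
move=> Fx xi; have [sx Vx] := Fx; apply: lt_le_trans xi _.
rewrite -[in leRHS]Vx V_linear_of_injective //; last first.
  by move=> ? ?; exact: (fixed_injective Fx).
by rewrite (bigD1 i) //= lerDl sumr_ge0 // => j _; exact: sx.1.
Qed.

(* [f] permutes the intersection of the two supports, and it contains
   [f i = f j]. *)
Lemma fixed_injective2 x y i j : fixed_points V x -> fixed_points V y ->
  0 < x i 0 -> 0 < y j 0 -> f i = f j -> i = j.
Proof.
move=> Fx Fy xi yj fij.
pose A := finset (fun l => (0 < x l 0) && (0 < y l 0)).
have fA : (imset f (mem A) \subset A)%SET.
  apply/fintype.subsetP => _ /imsetP[l /[!inE] /andP[xl yl] ->].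
  by rewrite !fixed_support_stable.
have Ak : f i \in A by rewrite inE {2}fij !fixed_support_stable.
have /eqP Af : imset f (mem A) == A.
  rewrite eqEcard fA card_in_imset ?leqnn //.
  by move=> a b /[!inE] /andP[xa _] /andP[xb _]; exact: (fixed_injective Fx).
(* A preimage [l] of [f i] in both supports equals [i] by injectivity on the support of [x], and [j]
   by that on the support of [y]. *)
move: Ak; rewrite -Af => /imsetP[l /[!inE] /andP[xl yl] fil].
have -> := fixed_injective Fx xi xl fil.
by apply: (fixed_injective Fy yl yj); rewrite -fil.
Qed.

(** The support of a point of the segment lies in the union of the two supports, where [f] is
    injective; [V] is then linear along the segment and fixes both ends. *)
Lemma fixed_segment x y t : fixed_points V x -> fixed_points V y ->
  0 <= t <= 1 -> fixed_points V (x + t *: (y - x)).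
Proof.
move=> Fx Fy t01; have [[sx Vx] [sy Vy]] := (Fx, Fy).
have sz := simplex_segment sx sy t01; split=> //.
have zpos i : 0 < (x + t *: (y - x)) i 0 -> 0 < x i 0 \/ 0 < y i 0.
  move=> zi; have [xi|xi] := ltP 0 (x i 0); [by left|right].
  move: zi; rewrite !mxE; have := sx.1 i; case/andP: t01 => t0 t1.
  by move=> ? ?; rewrite ltNge; apply/negP => ?; clear Vx Vy; nra.
apply/colP => k; rewrite V_linear_of_injective //; last first.
  move=> i j /zpos[xi|yi] /zpos[xj|yj] fij.
  - exact: (fixed_injective Fx).
  - exact: (fixed_injective2 Fx Fy).
  - exact: (fixed_injective2 Fy Fx).
  - exact: (fixed_injective Fy).
under eq_bigr do rewrite !mxE.
rewrite big_split -mulr_sumr sumrB /=.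
rewrite -(V_linear_of_injective sx); last by move=> ? ?; exact: (fixed_injective Fx).
rewrite -(V_linear_of_injective sy); last by move=> ? ?; exact: (fixed_injective Fy).
by rewrite Vx Vy !mxE.
Qed.

(* The barycentre of a cycle of [f], found as a minimal nonempty stable set. *)
Lemma exists_fixed_point : (0 < m)%N -> exists x, fixed_points V x.
Proof.
move=> m_gt0; pose stable (A : {set 'I_m}) :=
  (A != finset.set0) && (imset f (mem A) \subset A).
have stableT : stable finset.setT.
  rewrite /stable finset.subsetT andbT; apply/set0Pn.
  by exists (Ordinal m_gt0); rewrite inE.
have [A /andP[A0 fA] Amin] := arg_minnP (fun A : {set 'I_m} => #|A|) stableT.
(* The image of [A] is again stable, so by minimality it is no smaller than [A]. *)
have fAA : imset f (mem A) = A.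
  apply/eqP; rewrite eqEcard fA Amin //; apply/andP; split; last exact: imsetS.
  have /set0Pn[a aA] := A0; by apply/set0Pn; exists (f a); rewrite imset_f.
have finj : {in A &, injective f} by apply/imset_injP; rewrite fAA.
have cA : (#|A|%:R : R) != 0 by rewrite pnatr_eq0 cards_eq0.
pose x : 'cV[R]_m := \col_i ((i \in A)%:R / #|A|%:R).
have sx : simplex x.
  split=> [i|]; first by rewrite mxE divr_ge0.
  under eq_bigr do rewrite mxE.
  rewrite -mulr_suml -natr_sum.
  have -> : (\sum_(i < m) (i \in A) = #|A|)%N.
    by rewrite -sum1_card [RHS]big_mkcond; apply: eq_bigr => i _; case: ifP.
  exact: divff.
exists x; split=> //; apply/colP => k.
have inA i : 0 < x i 0 -> i \in A.
  by rewrite mxE; case: (i \in A) => //; rewrite mul0r ltxx.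
rewrite V_linear_of_injective //; last first.
  by move=> i j /inA iA /inA jA; exact: finj.
under eq_bigr do rewrite mxE.
rewrite -mulr_suml mxE; congr (_ / _).
have [|kA] := boolP (k \in A).
  rewrite -{1}fAA => /imsetP[i iA ->]; rewrite (bigD1 i) //= iA big1 ?addr0 //.
  move=> j /andP[/eqP fji]; case: (boolP (j \in A)) => // jA.
  by rewrite (finj _ _ jA iA fji) eqxx.
rewrite big1 // => i /eqP fik; case: (boolP (i \in A)) => // iA.
by move: kA; rewrite -fik -fAA imset_f.
Qed.

End DissipativeOperators.

Theorem theorem3p1 (R : realType) (m : nat) (m_gt0 : (0 < m)%N)
    (V : 'cV[R]_m -> 'cV[R]_m) (hV : dissipative_qso V) :
  (exists! x : 'cV[R]_m, fixed_points V x) \/ infinite_set (fixed_points V).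
Proof.
have [[Vsimplex [p [p_sym p_ge0 p_sum VE]]] Vdiss _] := hV.
have [f pf] := V_vertices Vsimplex p_ge0 p_sum VE Vdiss.
have [x Fx] := exists_fixed_point Vsimplex p_sym p_ge0 p_sum VE Vdiss pf m_gt0.
have [|nuniq] := pselect (exists! x, fixed_points V x); [by left|right].
have [y Fy yx] : exists2 y, fixed_points V y & y != x.
  apply: contrapT => noy; apply: nuniq; exists x; split=> // y Fy.
  by apply/eqP; rewrite eq_sym; apply: contra_notT noy => ?; exists y.
(* Since [y != x], distinct parameters in []0, 1]] give distinct fixed points of the segment. *)
pose g (n : nat) := x + n.+1%:R^-1 *: (y - x).
have gF n : fixed_points V (g n).
  apply: (fixed_segment Vsimplex p_sym p_ge0 p_sum VE Vdiss pf Fx Fy).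
  by rewrite invr_ge0 ler0n invf_le1 ?ltr0n // ler1n.
have ginj : injective g.
  move=> n n' /addrI/eqP; rewrite -subr_eq0 -scalerBl scaler_eq0 subr_eq0.
  rewrite [y - x == 0]subr_eq0 (negPf yx) orbF (inj_eq invr_inj) eqr_nat.
  by move=> /eqP[].
move=> finF; apply: infinite_nat.
have -> : [set: nat] = g @^-1` fixed_points V by apply/seteqP; split=> n _ //; exact: gF.
by apply: finite_preimage finF => a b _ _; exact: ginj.
Qed.
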